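(* Let $K$ be a field, let $S$ be a positively graded $K$-algebra, let $M=\bigoplus_{n\ge 0}M_n$ be a finitely generated graded $S$-module, and let $w>0$ be a real number. For any integer $k\geq 0$, it holds that $$\zeta_{M(-k)}(z,w)=\zeta_M(z,w+k).$$
   Context: A positively graded $K$-algebra is a finitely generated graded $K$-algebra $S=\bigoplus_{n\ge0}S_n$ with $S_0=K$. $M(-k)$ denotes the shifted module with $M(-k)_n=M_{n-k}$ (where $M_i=0$ for $i<0$). For a finitely generated graded $S$-module $M=\bigoplus_{n\ge0}M_n$ put $H(M,n)=\dim_K M_n$ and, for real $w>0$, $\zeta_M(z,w)=\sum_{n\ge 0}\frac{H(M,n)}{(n+w)^z}$. The series converges absolutely for $\operatorname{Re} z>\dim M$ and is understood elsewhere by its meromorphic continuation to $\mathbb C$. *)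

(* Defs.v *)
From HB Require Import structures.
From mathcomp Require Import all_boot all_order all_algebra.
From mathcomp Require Import all_classical all_reals all_analysis.
From mathcomp Require Import complex.

Set Implicit Arguments.
Unset Strict Implicit.
Unset Printing Implicit Defensive.

Import Order.TTheory GRing.Theory Num.Theory.
Import numFieldNormedType.Exports.

Local Open Scope classical_set_scope.
Local Open Scope ring_scope.
Local Open Scope complex_scope.

(* Internal direct sum V = \bigoplus_(n >= 0) A n of additive subgroups. *)
Definition direct_decomposition (V : zmodType) (A : nat -> {pred V}) : Prop :=
  [/\ forall n, zmod_closed (A n),
      forall x : V, exists (n : nat) (f : nat -> V),
        (forall i, f i \in A i) /\ x = \sum_(i < n) f i
    & forall (n : nat) (f : nat -> V),
        (forall i, f i \in A i) -> \sum_(i < n) f i = 0 ->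
        forall i, (i < n)%N -> f i = 0].

Definition fg_algebra (K : fieldType) (S : comAlgType K) : Prop :=
  exists s : seq S, forall P : {pred S},
    GRing.subalg_closed P -> {subset s <= P} -> forall x, x \in P.

(* The degrees of the generators are arbitrary: S need not be generated in
   degree 1. *)
Record positively_graded (K : fieldType) (S : comAlgType K)
    (A : nat -> {pred S}) : Prop := PositivelyGraded {
  pg_decomposition : direct_decomposition A;
  pg_mul : forall i j x y, x \in A i -> y \in A j -> x * y \in A (i + j)%N;
  pg_zero : forall x, x \in A 0%N <-> exists c : K, x = c%:A;
  pg_fg : fg_algebra S }.

Definition fg_module (S : comNzRingType) (M : lmodType S) : Prop :=
  exists s : seq M, forall x : M,
    exists c : nat -> S, x = \sum_(i < size s) c i *: s`_i.

Record fg_graded_module (S : comNzRingType) (A : nat -> {pred S})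
    (M : lmodType S) (N : nat -> {pred M}) : Prop := FgGradedModule {
  gm_decomposition : direct_decomposition N;
  gm_scale : forall i j a x, a \in A i -> x \in N j -> a *: x \in N (i + j)%N;
  gm_fg : fg_module M }.

(* The grading of M(-k); the underlying module is M itself. *)
Definition shift_grading (V : zmodType) (N : nat -> {pred V}) (k : nat) :
    nat -> {pred V} :=
  fun n => if (k <= n)%N then N (n - k)%N else pred1 0.

Section Hilbert.
Variables (K : fieldType) (S : comAlgType K) (M : lmodType S).

(* K acts on M through the structure map c |-> c%:A of S. *)
Definition is_Kbasis (V : {pred M}) (d : nat) (b : 'I_d -> M) : Prop :=
  [/\ forall i, b i \in V,
      forall c : 'I_d -> K,
        \sum_i ((c i)%:A : S) *: b i = 0 -> forall i, c i = 0
    & forall x, x \in V ->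
        exists c : 'I_d -> K, x = \sum_i ((c i)%:A : S) *: b i].

(* For V infinite-dimensional this is 0; it is only used for the homogeneous
   components of a finitely generated graded module, which are
   finite-dimensional. *)
Definition dimK (V : {pred M}) : nat :=
  xget 0%N [set d : nat | exists b : 'I_d -> M, is_Kbasis V b].

Definition hilbert (N : nat -> {pred M}) (n : nat) : nat := dimK (N n).

End Hilbert.

Section KrullDimension.
Variables (S : comNzRingType) (M : lmodType S).

Definition is_prime_ideal (p : {pred S}) : Prop :=
  idealr_closed p /\ prime_idealr_closed p.

Definition contains_annihilator (p : {pred S}) : Prop :=
  forall a : S, (forall x : M, a *: x = 0) -> a \in p.

(* A chain p 0 < p 1 < ... < p n of primes containing Ann M. *)
Definition prime_chain (n : nat) (p : nat -> {pred S}) : Prop :=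
  (forall i, (i <= n)%N -> is_prime_ideal (p i) /\ contains_annihilator (p i))
  /\ (forall i, (i < n)%N ->
        {subset p i <= p i.+1} /\ ~ {subset p i.+1 <= p i}).

(* dim M = dim (S / Ann M); it is -oo for M = 0. *)
Definition krull_dim (R : realType) : \bar R :=
  ereal_sup [set (n%:R)%:E | n in [set n | exists p, prime_chain n p]].

End KrullDimension.

Section ComplexAnalysis.
Variable R : realType.

(* Principal branch, used for x > 0 only. *)
Definition cpow (x : R) (z : R[i]) : R[i] :=
  (expR (complex.Re z * ln x))%:C *
  (cos (complex.Im z * ln x) +i* sin (complex.Im z * ln x)).

(* A meromorphic function on the complex plane is represented as
   f : R[i] -> option R[i], with f z = None exactly at the poles of f. *)
Definition finite_part (f : R[i] -> option R[i]) : (R[i])^o -> (R[i])^o :=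
  fun z => odflt 0 (f z).

(* [derivable] is over the scalar field R[i]: complex differentiability. *)
Definition holomorphic_point (f : R[i] -> option R[i]) (z : R[i]) : Prop :=
  f z <> None /\ derivable (finite_part f) z (1 : (R[i])^o).

Definition holomorphic_at (f : R[i] -> option R[i]) (z : R[i]) : Prop :=
  \forall y \near (z : (R[i])^o), holomorphic_point f y.

Definition pole_at (f : R[i] -> option R[i]) (z : R[i]) : Prop :=
  [/\ f z = None,
      \forall y \near (z : (R[i])^o)^', holomorphic_point f y
    & forall B : R, \forall y \near (z : (R[i])^o)^',
        B%:C < `|finite_part f y| ].

Definition meromorphic (f : R[i] -> option R[i]) : Prop :=
  forall z, holomorphic_at f z \/ pole_at f z.

End ComplexAnalysis.

Section Zeta.
Variables (K : fieldType) (S : comAlgType K) (M : lmodType S).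
Variables (R : realType) (N : nat -> {pred M}) (w : R).

Definition zeta_term (z : R[i]) (n : nat) : (R[i])^o :=
  (hilbert N n)%:R / cpow (n%:R + w) z.

Definition is_zeta (f : R[i] -> option R[i]) : Prop :=
  meromorphic f /\
  forall z : R[i], (krull_dim M R < (complex.Re z)%:E)%E ->
    exists2 s : (R[i])^o, f z = Some s & series (zeta_term z) @ \oo --> s.

(* The meromorphic continuation; [zeta z = None] means that z is a pole. *)
Definition zeta : R[i] -> option R[i] := xget (fun=> None) is_zeta.

End Zeta.

(* Main.v *)
(* A function is a meromorphic continuation of the series of M(-k) at w if and
   only if it is one of the series of M at w + k, since both have the same
   partial sums up to k leading zero terms. As [zeta] is chosen from the set of
   continuations, no existence or uniqueness of the continuation is needed. *)
Require Import Defs.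
From HB Require Import structures.
From mathcomp Require Import all_boot all_order all_algebra.
From mathcomp Require Import all_classical all_reals all_analysis.
From mathcomp Require Import complex.

Set Implicit Arguments.
Unset Strict Implicit.
Unset Printing Implicit Defensive.

Import Order.TTheory GRing.Theory Num.Theory.
Import numFieldNormedType.Exports.

Local Open Scope classical_set_scope.
Local Open Scope ring_scope.

(** A nonempty basis would consist of zero vectors, and then the relation with all coefficients 1
    contradicts freeness. The default value of [xget] is 0 as well. *)
Lemma dimK_pred1_0 (K : fieldType) (S : comAlgType K) (M : lmodType S) :
  dimK (K := K) (pred1 (0 : M)) = 0%N.
Proof.
rewrite /dimK; case: xgetP => // -[//|d] _ [b [bV free _]].
have bE i : b i = 0 by apply/eqP; exact: bV.
have /free/(_ ord0)/eqP : \sum_i (((fun=> 1) i)%:A : S) *: b i = 0.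
  by rewrite big1// => i _; rewrite bE scaler0.
by rewrite oner_eq0.
Qed.

Lemma hilbert_shift_lt (K : fieldType) (S : comAlgType K) (M : lmodType S)
    (N : nat -> {pred M}) (k n : nat) : (n < k)%N ->
  hilbert (K := K) (shift_grading N k) n = 0%N.
Proof. by move=> nk; rewrite /hilbert /shift_grading leqNgt nk dimK_pred1_0. Qed.

Lemma hilbert_shiftD (K : fieldType) (S : comAlgType K) (M : lmodType S)
    (N : nat -> {pred M}) (k n : nat) :
  hilbert (K := K) (shift_grading N k) (n + k) = hilbert (K := K) N n.
Proof. by rewrite /hilbert /shift_grading leq_addl addnK. Qed.

Lemma series_zeta_shift (K : fieldType) (S : comAlgType K) (M : lmodType S)
    (R : realType) (N : nat -> {pred M}) (w : R) (k : nat) (z : R[i]) (n : nat) :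
  series (zeta_term (shift_grading N k) w z) (n + k)%N =
  series (zeta_term N (w + k%:R) z) n.
Proof.
rewrite /series /= (big_cat_nat (n := k)) ?leq_addl//= big_nat big1 ?add0r.
  rewrite -{1}[k]add0n big_addn addnK; apply: eq_bigr => i _.
  (* The terms match because (i + k) + w = i + (w + k). *)
  by rewrite /zeta_term hilbert_shiftD natrD -addrA [k%:R + w]addrC.
by move=> i /andP[_ ik]; rewrite /zeta_term hilbert_shift_lt// mul0r.
Qed.

(** An equality of predicates, so that it can be rewritten under the [xget] in [zeta]. *)
Lemma is_zeta_shift (K : fieldType) (S : comAlgType K) (M : lmodType S)
    (R : realType) (N : nat -> {pred M}) (w : R) (k : nat) :
  is_zeta (shift_grading N k) w = is_zeta N (w + k%:R).
Proof.
have cvgE z (s : (R[i])^o) :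
    (series (zeta_term (shift_grading N k) w z) @ \oo --> s) =
    (series (zeta_term N (w + k%:R) z) @ \oo --> s).
  (* Dropping the first k partial sums does not change the limit. *)
  rewrite -(cvg_shiftn k); congr (_ @ \oo --> s).
  by apply/funext => n; exact: series_zeta_shift.
apply/funext => f; apply/propext.
(* The half-plane in [is_zeta] depends on M and not on its grading, so it is the same on both
   sides. *)
by split=> -[mf fE]; split=> // z /fE[s fz cs]; exists s; rewrite // ?cvgE// -cvgE.
Qed.

Theorem proposition1p3 (K : fieldType) (S : comAlgType K) (A : nat -> {pred S})
    (hS : positively_graded A)
    (M : lmodType S) (N : nat -> {pred M}) (hM : fg_graded_module A N)
    (R : realType) (w : R) (hw : 0 < w) (k : nat) (z : R[i]) :
  zeta (shift_grading N k) w z = zeta N (w + k%:R) z.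
Proof.
by rewrite /zeta is_zeta_shift.
Qed.
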